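(* Let $G$ be a finite simple graph of order $n$. Then $$Mo^\star(G)\leq \left(\frac{2}{\sqrt{3}}-1\right)n^3\leq 0.1548\,n^3.$$
   Context: For a finite simple graph $G$ of order $n$ and a vertex $u$, $d_G(u)$ denotes the degree of $u$ in $G$. The parameter $Mo^\star(G)$ is defined as $Mo^\star(G)=\sum_{uv\in E(G)}\big(n-\min\{d_G(u),d_G(v)\}\big)$, the sum running over all edges $uv$ of $G$. *)

(* Defs.v *)
From mathcomp Require Import all_boot.

Set Implicit Arguments.
Unset Strict Implicit.
Unset Printing Implicit Defensive.

Record sgraph := SGraph {
  svertex :> finType;
  adj : rel svertex;
  adj_sym : symmetric adj;
  adj_irr : irreflexive adj }.

Definition graph_order (G : sgraph) : nat := #|G|.

Definition deg (G : sgraph) (u : G) : nat := #|[set v | adj u v]|.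

(* Edges are two-element vertex sets, so each edge is counted once. *)
Definition edges (G : sgraph) : {set {set G}} :=
  [set [set p.1; p.2] | p : G * G & adj p.1 p.2].

(* [graph_order G] exceeds every degree, so it is a neutral starting value;
   edge_mindegE gives the value on an edge. *)
Definition edge_mindeg (G : sgraph) (e : {set G}) : nat :=
  \big[minn/graph_order G]_(u in e) deg u.

(* The subtraction on nat never truncates, since degrees are below the order. *)
Definition Mo_star (G : sgraph) : nat :=
  \sum_(e in edges G) (graph_order G - edge_mindeg e).

Lemma deg_lt_order (G : sgraph) (u : G) : deg u < graph_order G.
Proof.
rewrite /graph_order -cardsT; apply: proper_card.
by rewrite properT; apply/eqP => /setP/(_ u); rewrite !inE adj_irr.
Qed.

Lemma edge_mindegE (G : sgraph) (u v : G) :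
  edge_mindeg [set u; v] = minn (deg u) (deg v).
Proof.
have leE m : (m <= edge_mindeg [set u; v]) =
    (m <= graph_order G) && [forall w in [set u; v], m <= deg w].
  rewrite -big_andE /edge_mindeg.
  elim/big_rec2: _ => [|w b x _ IH]; first by rewrite andbT.
  by rewrite leq_min IH andbCA.
apply/eqP; rewrite eqn_leq leq_min; apply/andP; split.
  have := leqnn (edge_mindeg [set u; v]); rewrite leE.
  case/andP=> _ /forall_inP H.
  by rewrite !H // !inE eqxx ?orbT.
rewrite leE geq_min ltnW ?deg_lt_order //=; apply/forall_inP => w.
by rewrite !inE => /orP[] /eqP->; rewrite geq_min leqnn ?orbT.
Qed.

(* Main.v *)
Require Import Defs.
From HB Require Import structures.
From mathcomp Require Import all_boot all_order all_algebra.
From mathcomp Require Import reals.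
From mathcomp Require Import ring lra.

Set Implicit Arguments.
Unset Strict Implicit.
Unset Printing Implicit Defensive.

Import Order.TTheory GRing.Theory Num.Theory.
Local Open Scope ring_scope.

(** List the vertices by increasing degree.  Then [Mo_star] is the sum over
    adjacent pairs [x < y] of [c x], the number of non-neighbours of [x]
    ([x] included).  Give the vertices weights [w] and consider the sum [J] of
    [w x * w y * c x], with [c x] now a weight: [J <= C * W ^+ 3], where [W] is
    the total weight and [C = 2 / sqrt 3 - 1], by induction on the number of
    vertices.  If the first vertex is not joined to some other vertex, let [y]
    be the first such one: [J] is affine along a transfer of weight between the
    two, so one of them may be given weight 0 and deleted.  Otherwise the first
    vertex, of weight [w], contributes exactly [w ^+ 2 * a], where [a] is the
    weight of the others, and [C] is the least constant such that
    [w ^+ 2 * a + C * a ^+ 3 <= C * (w + a) ^+ 3] always holds. *)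

(** * Affine functions of one variable *)

Section Affine.
Variable R : realFieldType.

Definition affine (g : R -> R) := exists A B, forall a, g a = A + B * a.

Lemma affine_cst A : affine (fun=> A).
Proof. by exists A, 0 => a; rewrite mul0r addr0. Qed.

Lemma affine_id : affine id.
Proof. by exists 0, 1 => a; rewrite mul1r add0r. Qed.

Lemma affineD g h : affine g -> affine h -> affine (fun a => g a + h a).
Proof.
by move=> [A [B gE]] [A' [B' hE]]; exists (A + A'), (B + B') => a;
   rewrite gE hE; ring.
Qed.

Lemma affineMl k g : affine g -> affine (fun a => k * g a).
Proof. by move=> [A [B gE]]; exists (k * A), (k * B) => a; rewrite gE; ring. Qed.

Lemma affineMr k g : affine g -> affine (fun a => g a * k).
Proof. by move=> [A [B gE]]; exists (A * k), (B * k) => a; rewrite gE; ring. Qed.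

Lemma affineBl k : affine (fun a => k - a).
Proof. by exists k, (- 1) => a; ring. Qed.

Lemma eq_affine g h : g =1 h -> affine h -> affine g.
Proof. by move=> gh [A [B hE]]; exists A, B => a; rewrite gh. Qed.

Lemma affine_le_endpoints g s a M :
  affine g -> 0 <= a <= s -> g 0 <= M -> g s <= M -> g a <= M.
Proof.
move=> [A [B gE]] /andP[a0 as_]; rewrite !gE => g0 gs.
have [B0|B0] := leP 0 B; first by have := ler_wpM2l B0 as_; lra.
by have := mulr_le0_ge0 (ltW B0) a0; lra.
Qed.

End Affine.

(** * Weighted vertex lists and the cubic bound *)

Section WeightedGraph.
Variables (R : realFieldType) (T : Type) (e : rel T).
Hypotheses (e_sym : symmetric e) (e_irr : irreflexive e).
Implicit Types (L l : seq (T * R)) (x : T).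

Definition weight l : R := \sum_(p <- l) p.2.
Definition nbr_weight l x : R := \sum_(p <- l | e x p.1) p.2.
(** Weighted form of the order minus the degree: the weight of [x] itself is included, since [e] is
    irreflexive. *)
Definition conbr_weight l x : R := \sum_(p <- l | ~~ e x p.1) p.2.

(* Codegrees are taken in the whole list [L], while [l] runs over its
   suffixes; the sum [J] is [forward_sum L L]. *)
Fixpoint forward_sum L l : R :=
  if l is p :: l' then
    p.2 * conbr_weight L p.1 * nbr_weight l' p.1 + forward_sum L l'
  else 0.

Lemma eq_forward_sum L L' l :
  (forall x, conbr_weight L x = conbr_weight L' x) ->
  forward_sum L l = forward_sum L' l.
Proof. by move=> LL'; elim: l => //= p l ->; rewrite LL'. Qed.

Lemma forward_sum_drop0 L l1 x l2 :
  forward_sum L (l1 ++ (x, 0) :: l2) = forward_sum L (l1 ++ l2).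
Proof.
elim: l1 => [|p l1 IH] /=; first by rewrite !mul0r add0r.
rewrite IH; congr (_ * _ + _).
by rewrite /nbr_weight !big_cat big_cons /= add0r if_same.
Qed.

Lemma conbr_weight_drop0 l1 y l2 x :
  conbr_weight (l1 ++ (y, 0) :: l2) x = conbr_weight (l1 ++ l2) x.
Proof. by rewrite /conbr_weight !big_cat big_cons /= add0r if_same. Qed.

(** In the list, [p] is its own only non-neighbour, and it enters the codegree of no vertex of
    [l]. *)
Lemma forward_sum_cons_joined p l :
  all (fun q => e p.1 q.1) l ->
  forward_sum (p :: l) (p :: l) = p.2 ^+ 2 * weight l + forward_sum l l.
Proof.
move=> /= pl; congr (_ + _).
  suff [-> ->] : conbr_weight (p :: l) p.1 = p.2 /\ nbr_weight l p.1 = weight l.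
    by [].
  rewrite /conbr_weight /nbr_weight big_cons e_irr /= /weight.
  elim: l pl => [|q l IH] /=; first by rewrite !big_nil addr0.
  by case/andP=> pq /IH[c n]; rewrite !big_cons pq /= n c.
suff H m : all (fun q => e p.1 q.1) m -> forward_sum (p :: l) m = forward_sum l m.
  exact: H.
elim: m => //= q m IH /andP[pq /IH->].
by rewrite {1}/conbr_weight big_cons e_sym pq.
Qed.

(* [y] is the first vertex not joined to the first vertex [x], so no vertex
   counts the weight of [x] in its codegree and that of [y] among its later
   neighbours: the quadratic terms in [a] vanish. *)
Lemma forward_sum_transfer x l1 y l2 s :
  all (fun q => e x q.1) l1 -> ~~ e x y ->
  let L a := (x, a) :: l1 ++ (y, s - a) :: l2 in
  affine (fun a => forward_sum (L a) (L a)).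
Proof.
move=> xl1 xy L.
have cE a z : conbr_weight (L a) z =
    (if e z x then 0 else a) + (if e z y then 0 else s - a)
    + conbr_weight (l1 ++ l2) z.
  rewrite /conbr_weight big_cons !big_cat big_cons /=.
  by case: (e z x); case: (e z y) => /=; ring.
have fE a m z : nbr_weight (m ++ (y, s - a) :: l2) z =
    (if e z y then s - a else 0) + nbr_weight (m ++ l2) z.
  by rewrite /nbr_weight !big_cat big_cons /=; case: (e z y) => /=; ring.
have c_affine z : affine (fun a => conbr_weight (L a) z).
  apply: eq_affine (fun a => cE a z) _.
  apply: affineD; last exact: affine_cst.
  apply: affineD; [case: (e z x) | case: (e z y)];
    by [exact: affine_cst | exact: affine_id | exact: affineBl].
(* In a suffix [m] independent of [a], only the codegrees vary. *)
have cst_affine m : affine (fun a => forward_sum (L a) m).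
  elim: m => [|q m IH] /=; first exact: affine_cst.
  by apply: affineD IH; apply/affineMr/affineMl.
have yl2_affine : affine (fun a => forward_sum (L a) ((y, s - a) :: l2)).
  rewrite /=; apply: affineD (cst_affine _); apply: affineMr.
  (* Both [x] and [y] are non-neighbours of [y], so [a] and [s - a] add up to [s] in its
     codegree. *)
  apply: (@eq_affine _ _ (fun a => (s - a) * (s + conbr_weight (l1 ++ l2) y))).
    by move=> a; rewrite cE e_sym (negbTE xy) e_irr; ring.
  exact/affineMr/affineBl.
have rest_affine m : all (fun q => e x q.1) m ->
    affine (fun a => forward_sum (L a) (m ++ (y, s - a) :: l2)).
  elim: m => [|q m IH] //= /andP[xq /IH{}IH].
  (* Here [q] is joined to [x]. If it is joined to [y] too, its codegree is free of [a]; if not, the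
     weight of its later neighbours is. *)
  apply: affineD IH; case qy: (e q.1 y).
    apply: (@eq_affine _ _ (fun a => q.2 * conbr_weight (l1 ++ l2) q.1 *
        (s - a + nbr_weight (m ++ l2) q.1))).
      by move=> a; rewrite cE fE [e q.1 x]e_sym xq qy /=; ring.
    by apply/affineMl/affineD; [exact: affineBl | exact: affine_cst].
  apply: (@eq_affine _ _ (fun a => q.2 * conbr_weight (L a) q.1 *
      nbr_weight (m ++ l2) q.1)).
    by move=> a; rewrite fE qy add0r.
  exact/affineMr/affineMl.
rewrite /L /=; apply: affineD (rest_affine _ xl1).
(* The codegree of [x] is constant for the same reason, and [y] is not among its neighbours. *)
apply: (@eq_affine _ _ (fun a =>
  a * ((s + conbr_weight (l1 ++ l2) x) * nbr_weight (l1 ++ l2) x))).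
  by move=> a; rewrite cE fE (negbTE xy) e_irr; ring.
exact/affineMr/affine_id.
Qed.

Variable C : R.
(** A form of [C = 2 / sqrt 3 - 1] without square roots: the equation is [3 * (C + 1) ^+ 2 = 4]
    expanded. *)
Hypotheses (C_gt0 : 0 < C) (C_root : 3 * C ^+ 2 + 6 * C = 1).

(* The discriminant of [C w^2 + (3C - 1) w a + 3C a^2] vanishes. *)
Lemma cubic_step w a : 0 <= w -> 0 <= a ->
  w ^+ 2 * a + C * a ^+ 3 <= C * (w + a) ^+ 3.
Proof.
move=> w0 a0.
have sq : 4 * C * (C * w ^+ 2 + (3 * C - 1) * w * a + 3 * C * a ^+ 2) =
    (2 * C * w + (3 * C - 1) * a) ^+ 2.
  have := congr1 (fun t => t * a ^+ 2) C_root; lra.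
have q0 : 0 <= C * w ^+ 2 + (3 * C - 1) * w * a + 3 * C * a ^+ 2.
  by rewrite -(@pmulr_rge0 _ (4 * C)) ?sq ?sqr_ge0 // mulr_gt0.
(* The difference of the two sides is [w] times the quadratic form. *)
have := mulr_ge0 w0 q0; lra.
Qed.

Lemma forward_sum_le L :
  all (fun p : T * R => 0 <= p.2) L -> forward_sum L L <= C * weight L ^+ 3.
Proof.
have [k] := ubnP (size L); elim: k L => // k IH [|[x a] l] lk.
  by rewrite /weight big_nil expr0n mulr0.
case/andP; rewrite -/(all _ l) => a0 l0; rewrite /= in a0 lk.
have [xl|] := boolP (all (fun q => e x q.1) l).
  rewrite (forward_sum_cons_joined (p := (x, a))) // /weight big_cons.
  apply: le_trans (cubic_step a0 _); first by rewrite lerD2l IH.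
  by elim: l l0 {lk xl} => [|q l Il] /=; rewrite ?big_nil ?big_cons //
     => /andP[q0 /Il]; apply: addr_ge0.
rewrite -has_predC => nxl; case/split_find: nxl l0 lk => -[y b] l1 l2 xy.
rewrite has_predC negbK cat_rcons all_cat => xl1 /and3P[l10 b0 l20] lk.
rewrite /= in xy b0.
pose L c := (x, c) :: l1 ++ (y, a + b - c) :: l2.
have -> : (x, a) :: l1 ++ (y, b) :: l2 = L a by rewrite /L addrC addKr.
have wE c : weight (L c) = a + b + weight (l1 ++ l2).
  by rewrite /weight big_cons !big_cat big_cons /=; ring.
rewrite wE.
apply: (@affine_le_endpoints _ (fun c => forward_sum (L c) (L c)) (a + b) a).
- exact: forward_sum_transfer.
- by rewrite a0 lerDl b0.
(* At [c = 0] the vertex [x] is deleted and [y] carries the weight [a + b]. *)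
- rewrite (forward_sum_drop0 _ [::]) (eq_forward_sum _ (conbr_weight_drop0 [::] x _)) !cat0s.
  have -> : a + b + weight (l1 ++ l2) = weight (l1 ++ (y, a + b - 0) :: l2).
    by rewrite /weight !big_cat big_cons /=; ring.
  apply: IH; last by rewrite all_cat; apply/and3P; rewrite /= subr0 addr_ge0.
  by move: lk; rewrite !size_cat.
(* At [c = a + b] the vertex [y] is deleted instead. *)
- rewrite /L subrr (forward_sum_drop0 _ ((x, a + b) :: l1)).
  rewrite (eq_forward_sum _ (conbr_weight_drop0 ((x, a + b) :: l1) y l2)) cat_cons.
  have -> : a + b + weight (l1 ++ l2) = weight ((x, a + b) :: l1 ++ l2).
    by rewrite /weight big_cons.
  apply: IH; last by rewrite /= addr_ge0 //= all_cat; apply/andP.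
  by move: lk; rewrite /= !size_cat /= addnS.
Qed.

End WeightedGraph.

(** * From the graph to its list of vertices sorted by degree *)

Lemma forward_sum_index (R : realFieldType) (T : eqType) (e : rel T)
    (L : seq (T * R)) (s : seq T) :
  uniq s -> forward_sum e L [seq (x, 1) | x <- s] =
  \sum_(x <- s) \sum_(y <- s | e x y && (index x s < index y s)%N)
    conbr_weight e L x.
Proof.
elim: s => [|x s IH] /=; first by rewrite big_nil.
case/andP=> xs /IH->; rewrite mul1r big_cons; congr (_ + _).
  rewrite big_cons eqxx ltnn andbF /nbr_weight big_map mulr_sumr [LHS]big_seq_cond.
  rewrite [RHS]big_seq_cond; apply: eq_big => [y|y _]; last by rewrite mulr1.
  by case: eqP => [<-|_] /=; rewrite ?(negbTE xs) ?ltn0Sn ?andbT.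
(* Prepending [x] shifts all other positions by one, so their comparisons persist, and no vertex
   precedes [x]. *)
rewrite [LHS]big_seq [RHS]big_seq; apply: eq_bigr => y ys.
rewrite big_cons eqxx ltn0 andbF [LHS]big_seq_cond [RHS]big_seq_cond.
apply: eq_bigl => z; case: (eqVneq x y) => [xy|_]; first by rewrite xy ys in xs.
by case: (eqVneq x z) => [<-|_] //; rewrite (negbTE xs).
Qed.

(** The injective rank [r] orients every edge upwards, so each edge comes from exactly one ordered
    pair. *)
Lemma edges_sum (R : nmodType) (G : sgraph) (r : G -> nat) (F : {set G} -> R) :
  injective r ->
  \sum_(f in edges G) F f =
  \sum_(p : G * G | adj p.1 p.2 && (r p.1 < r p.2)%N) F [set p.1; p.2].
Proof.
move=> r_inj; pose D := [set p : G * G | adj p.1 p.2 && (r p.1 < r p.2)%N].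
have -> : edges G = [set [set p.1; p.2] | p in D].
  apply/setP=> f; apply/imsetP/imsetP => -[[u v] /=]; rewrite inE /=; last first.
    by case/andP=> uv _ ->; exists (u, v); rewrite ?inE.
  move=> uv ->; case: (ltngtP (r u) (r v)) => [lt|gt|/r_inj eq].
  - by exists (u, v); rewrite ?inE ?uv.
  - by exists (v, u); rewrite ?inE /= 1?adj_sym ?uv // setUC.
  - by rewrite eq adj_irr in uv.
rewrite big_imset; first by apply: eq_bigl => p; rewrite inE.
move=> [u v] [u' v']; rewrite !inE /= => /andP[_ uv] /andP[_ uv'] E.
have : u \in [set u'; v'] by rewrite -E set21.
have : v \in [set u'; v'] by rewrite -E set22.
move: uv; rewrite !inE => uv /orP[]/eqP vE /orP[]/eqP uE; move: uv.
- by rewrite uE vE ltnn.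
- by rewrite uE vE ltnNge ltnW.
- by rewrite uE vE.
- by rewrite uE vE ltnn.
Qed.

Lemma Mo_star_forward_sum (R : realFieldType) (G : sgraph) :
  exists2 L : seq (G * R), all (fun p : G * R => 0 <= p.2) L /\
    weight L = (graph_order G)%:R & (Mo_star G)%:R = forward_sum (@adj G) L L.
Proof.
pose le_deg := relpre (@deg G) leq.
pose s := sort le_deg (enum G).
have le_tr : transitive le_deg by move=> y x z; apply: leq_trans.
have s_sorted : sorted le_deg s by apply: sort_sorted => x y; apply: leq_total.
have s_perm : perm_eq s (enum G) by rewrite perm_sort.
have s_mem x : x \in s by rewrite mem_sort mem_enum.
have sumE (P : pred G) (F : G -> R) :
    \sum_(x <- s | P x) F x = \sum_(x | P x) F x.
  by rewrite (perm_big _ s_perm) big_enum_cond.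
pose r x := index x s.
have r_inj : injective r by move=> x y; apply: index_inj.
exists [seq (x, 1) | x <- s].
  split; first by rewrite all_map; apply/allP => x _ /=.
  by rewrite /weight big_map sumE sumr_const.
rewrite forward_sum_index; last by rewrite sort_uniq enum_uniq.
rewrite sumE; under eq_bigr do rewrite sumE.
rewrite pair_big_dep /= /Mo_star natr_sum (edges_sum _ r_inj).
(* The earlier endpoint [x] has the smaller degree, and with unit weights its codegree is the order
   minus that degree. *)
apply: eq_bigr => -[x y] /= /andP[xy /(sorted_ltn_index le_tr s_sorted) xy_deg].
rewrite edge_mindegE (minn_idPl _); last exact: xy_deg.
rewrite /conbr_weight big_map sumE sumr_const; congr (_%:R).
rewrite /graph_order -(cardsC [set v | adj x v]) addKn.
by apply: eq_card => v; rewrite !inE.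
Qed.

Lemma extremal_constant (R : realFieldType) (C : R) :
  0 < C + 1 -> 3 * (C + 1) ^+ 2 = 4 ->
  [/\ 0 < C, 3 * C ^+ 2 + 6 * C = 1 & C <= 1548 / 10 ^+ 4].
Proof.
(* As [C + 1] is positive, the bounds on [C] follow from [3 < 4] and [4 < 3 * 1.1548 ^ 2]. *)
by move=> C_gtN1 C_sq; split; nra.
Qed.

Theorem theorem1 (R : realType) (n : nat) (G : sgraph) (hn : graph_order G = n) :
  (Mo_star G)%:R <= (2 / Num.sqrt 3 - 1) * n%:R ^+ 3 :> R /\
  (2 / Num.sqrt 3 - 1) * n%:R ^+ 3 <= (1548 / 10 ^+ 4) * n%:R ^+ 3 :> R.
Proof.
set C : R := 2 / Num.sqrt 3 - 1.
have C_sq : 3 * (C + 1) ^+ 2 = 4.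
  by rewrite /C subrK expr_div_n sqr_sqrtr ?ler0n //; field.
have C_gtN1 : 0 < C + 1 by rewrite /C subrK divr_gt0 ?sqrtr_gt0 ?ltr0n.
have [C_gt0 C_root C_le] := extremal_constant C_gtN1 C_sq.
split; last by rewrite ler_wpM2r ?exprn_ge0.
have [L [L_ge0 Lw] ->] := Mo_star_forward_sum R G.
rewrite -hn -Lw; apply: forward_sum_le => //; first exact: adj_sym.
exact: adj_irr.
Qed.
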